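(* Let $(M,g)$ be a compact Riemannian manifold of dimension $d$ and let $H(x,\xi)$, homogeneous of degree $2$ in $\xi$ with $\{H=1\}=S^*M$, be the Hamiltonian of a completely integrable system on $T^*M\setminus 0$ which is Kolmogorov non-degenerate. Then there exists an open dense set in $S^*M=\{H=1\}$ on which the system is iso-energetically non-degenerate.
   Context: A completely integrable system on $T^*M\setminus0$ consists of $d$ Poisson commuting smooth functions $p_1,\dots,p_d$, one of which is $H$ (or of which $H$ is a function), with moment map $\mathcal{P}=(p_1,\dots,p_d)$ proper onto its image. A point is regular if $dp_1\wedge\dots\wedge dp_d\ne0$ there; a regular point is compact if its orbit under the $\mathbb{R}^d$-action generated by the Hamiltonian flows of the $p_j$ is compact (hence a Lagrangian torus). The set of compact regular points is assumed to be open and dense in $T^*M\setminus 0$ and in $S^*M$. Near a compact regular point there are local action-angle variables $(I,\theta)$, $I=(I_1,\dots,I_d)$ in an open subset of $\mathbb{R}^d$, $\theta\in\mathbb{R}^d/\mathbb{Z}^d$ (up to normalization of periods), symplectic, such that the orbits are the tori $\{I=\text{const}\}$ and $H=F(I)$. The system is Kolmogorov non-degenerate if $\det\big(\frac{\partial^2F}{\partial I_j\partial I_k}\big)\neq0$ at compact regular points. It is iso-energetically non-degenerate at a compact regular point if $$\det\begin{pmatrix}\frac{\partial^2F}{\partial I_j\partial I_k}&\frac{\partial F}{\partial I_j}\\ \frac{\partial F}{\partial I_k}&0\end{pmatrix}\ne0$$ there. *)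

(* Defs.v *)
From HB Require Import structures.
From mathcomp Require Import all_boot all_order all_algebra.
From mathcomp Require Import all_classical all_reals all_analysis.

Set Implicit Arguments.
Unset Strict Implicit.
Unset Printing Implicit Defensive.

Import Order.TTheory GRing.Theory Num.Theory.
Import numFieldNormedType.Exports.

Local Open Scope classical_set_scope.
Local Open Scope ring_scope.

Section Smoothness.
Context {R : realType} {V W : normedModType R}.

(* Meant for finite-dimensional V and open U, where C^1 amounts to
   differentiability together with continuity of every x |-> df_x(v). *)
Fixpoint Ck_on (k : nat) (U : set V) (f : V -> W) : Prop :=
  if k is k'.+1 then
    (forall x, U x -> differentiable f x) /\
    (forall v : V, Ck_on k' U ('D_v f))
  else forall x, U x -> {for x, continuous f}.

Definition smooth_on (U : set V) (f : V -> W) : Prop :=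
  forall k, Ck_on k U f.

End Smoothness.

(* A smooth structure is given by an atlas, which need not be maximal.  Away
   from [dom a] and [chart_image a] the values of [coord a] and [param a] are junk. *)
Record smooth_manifold (R : realType) (d : nat) (M : topologicalType) := {
  chart : Type;
  dom : chart -> set M;
  coord : chart -> M -> 'rV[R]_d;
  param : chart -> 'rV[R]_d -> M;
  manifold_hausdorff : hausdorff_space M;
  manifold_second_countable : @second_countable M;
  dom_open : forall a, open (dom a);
  chart_image_open : forall a, open (coord a @` dom a);
  coordK : forall a x, dom a x -> param a (coord a x) = x;
  coord_continuous : forall a x, dom a x -> {for x, continuous (coord a)};
  param_continuous : forall a y, (coord a @` dom a) y ->
    {for y, continuous (param a)};
  dom_cover : forall x, exists a, dom a x;
  transition_smooth : forall a b,
    smooth_on (coord a @` (dom a `&` dom b)) (coord b \o param a)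
}.

Definition chart_image (R : realType) (d : nat) (M : topologicalType)
  (A : smooth_manifold R d M) (a : chart A) : set 'rV[R]_d :=
  coord a @` dom a.

(* Jacobian at m of the change of coordinates from a to b, acting on row
   vectors on the right: tangent components transform by v_b = v_a *m J. *)
Definition change_jac (R : realType) (d : nat) (M : topologicalType)
  (A : smooth_manifold R d M) (a b : chart A) (m : M) : 'M[R]_d :=
  'J (coord b \o param a) (coord a m).

(* A covector is the family of its components in all the charts around its
   base point; invariance of the pairing xi_a v_a^T = xi_b v_b^T gives the
   transformation law.  The components in the other charts are set to 0, so
   that equal covectors are Leibniz equal. *)
Record cotangent (R : realType) (d : nat) (M : topologicalType)
    (A : smooth_manifold R d M) := Cotangent {
  base : M;
  component : chart A -> 'rV[R]_d;
  comp_out : forall a, ~ dom a base -> component a = 0;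
  comp_change : forall a b, dom a base -> dom b base ->
    component a = component b *m (change_jac a b base)^T
}.

Section CotangentBundle.
Context {R : realType} {d : nat} {M : topologicalType}.
Variable A : smooth_manifold R d M.
Notation E := ('rV[R]_d * 'rV[R]_d)%type.

Lemma transition_differentiable (a b : chart A) m : dom a m -> dom b m ->
  differentiable (coord b \o param a) (coord a m).
Proof.
move=> am bm; have [+ _] := @transition_smooth _ _ _ A a b 1%N.
by apply; exists m.
Qed.

Lemma mul_jacobian (f : 'rV[R]_d -> 'rV[R]_d) x (v : 'rV[R]_d) :
  v *m 'J f x = 'd f x v.
Proof. by rewrite /jacobian mul_rV_lin1. Qed.

Lemma jacobian_comp_near (f h k : 'rV[R]_d -> 'rV[R]_d) x :
  differentiable f x -> differentiable h (f x) -> differentiable k x ->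
  (\near x, (h \o f) x = k x) -> 'J k x = 'J f x *m 'J h (f x).
Proof.
move=> df dh dk hfk.
have dhf : differentiable (h \o f) x := differentiable_comp df dh.
have e v : 'd k x v = 'd h (f x) ('d f x v).
  transitivity ('D_v k x); first exact/esym/deriveE.
  transitivity ('D_v (h \o f) x); first exact/esym/near_eq_derive.
  apply: (etrans (deriveE v dhf)).
  exact: (congr1 (fun D : _ -> _ => D v) (diff_comp df dh)).
move: e; rewrite /jacobian.
move: ('d k x) ('d f x) ('d h (f x)) => K D D' e.
apply/row_matrixP => i; rewrite !rowE mulmxA !mul_rV_lin1; exact: e.
Qed.

Lemma change_jac_chain (a b c : chart A) m : dom a m -> dom b m -> dom c m ->
  change_jac a c m = change_jac a b m *m change_jac b c m.
Proof.
move=> am bm cm; rewrite /change_jac.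
have pE : coord b m = (coord b \o param a) (coord a m).
  by rewrite /= coordK.
have dbc := transition_differentiable bm cm.
rewrite pE in dbc; rewrite [in X in _ = _ *m X]pE.
apply: jacobian_comp_near => //; try exact: transition_differentiable.
have cont : {for coord a m, continuous (param a)}.
  by apply: param_continuous; exists m.
have nb : nbhs (param a (coord a m)) (dom b).
  by rewrite coordK//; apply: open_nbhs_nbhs; split => //; exact: dom_open.
have := cont _ nb; rewrite nbhs_simpl /=; apply: filterS => y /= by_.
by rewrite coordK.
Qed.

Section FromChart.
Variables (a : chart A) (m : M) (xi : 'rV[R]_d).

Definition cot_comp (b : chart A) : 'rV[R]_d :=
  if `[< dom a m /\ dom b m >] then xi *m (change_jac b a m)^T else 0.

Lemma cot_comp_out b : ~ dom b m -> cot_comp b = 0.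
Proof. by move=> bm; rewrite /cot_comp; case: asboolP => // -[]. Qed.

Lemma cot_comp_change b c : dom b m -> dom c m ->
  cot_comp b = cot_comp c *m (change_jac b c m)^T.
Proof.
move=> bm cm; rewrite /cot_comp; case: asboolP => [[am _]|nam].
  have -> : `[< dom a m /\ dom c m >] by apply/asboolP; split.
  by rewrite -mulmxA -trmx_mul -(change_jac_chain bm cm am).
have /asboolPn/negbTE -> : ~ (dom a m /\ dom c m) by case=> am _; apply: nam.
by rewrite mul0mx.
Qed.

(* The covector at m with components xi in the chart a around m; it is 0 when
   m is not in the domain of a. *)
Definition cot_at : cotangent A := Cotangent cot_comp_out cot_comp_change.

End FromChart.

Definition cot_dom (a : chart A) : set (cotangent A) := [set z | dom a (base z)].

(* Canonical coordinates (x, xi), position first. *)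
Definition cot_coord (a : chart A) (z : cotangent A) : E :=
  (coord a (base z), component z a).

Definition cot_param (a : chart A) (y : E) : cotangent A :=
  cot_at a (param a y.1) y.2.

Definition cot_codom (a : chart A) : set E := [set y | chart_image a y.1].

Definition cot_open (O : set (cotangent A)) : Prop :=
  forall a, open (cot_codom a `&` cot_param a @^-1` O).

Lemma cot_codom_open a : open (cot_codom a).
Proof.
have := @open_comp _ _ (fst : E -> 'rV[R]_d) (chart_image a).
by apply; [move=> x _; exact: cvg_fst | exact: chart_image_open].
Qed.

Lemma cot_openT : cot_open setT.
Proof. by move=> a; rewrite preimage_setT setIT; exact: cot_codom_open. Qed.

Lemma cot_openI : setI_closed cot_open.
Proof.
move=> O P oO oP a; rewrite preimage_setI.
rewrite -[cot_codom a in X in open X]setIid setIACA.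
by apply: openI; [exact: oO|exact: oP].
Qed.

Lemma cot_open_bigU (I : Type) (O : I -> set (cotangent A)) :
  (forall i, cot_open (O i)) -> cot_open (\bigcup_i O i).
Proof.
move=> oO a; rewrite preimage_bigcup setI_bigcupr.
by apply: bigcup_open => i _; exact: oO.
Qed.

HB.instance Definition _ := gen_eqMixin (cotangent A).
HB.instance Definition _ := gen_choiceMixin (cotangent A).
HB.instance Definition _ :=
  isOpenTopological.Build (cotangent A) cot_openT cot_openI cot_open_bigU.

Lemma scale_comp_out (l : R) (z : cotangent A) a :
  ~ dom a (base z) -> l *: component z a = 0.
Proof. by move=> /comp_out ->; rewrite scaler0. Qed.

Lemma scale_comp_change (l : R) (z : cotangent A) a b :
  dom a (base z) -> dom b (base z) ->
  l *: component z a = l *: component z b *m (change_jac a b (base z))^T.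
Proof. by move=> az bz; rewrite (comp_change az bz) scalemxAl. Qed.

Definition cot_scale (l : R) (z : cotangent A) : cotangent A :=
  Cotangent (@scale_comp_out l z) (@scale_comp_change l z).

Definition punctured : set (cotangent A) := [set z | exists a, component z a != 0].

End CotangentBundle.

Record riemannian_metric (R : realType) (d : nat) (M : topologicalType)
    (A : smooth_manifold R d M) := {
  metric : chart A -> M -> 'M[R]_d;
  metric_sym : forall a m, dom a m -> (metric a m)^T = metric a m;
  metric_pos : forall a m (v : 'rV[R]_d), dom a m -> v != 0 ->
    0 < (v *m metric a m *m v^T) 0 0;
  metric_change : forall a b m, dom a m -> dom b m ->
    metric a m = change_jac a b m *m metric b m *m (change_jac a b m)^T;
  metric_smooth : forall a, smooth_on (chart_image a) (metric a \o param a)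
}.

Definition cosphere (R : realType) (d : nat) (M : topologicalType)
  (A : smooth_manifold R d M) (g : riemannian_metric A) : set (cotangent A) :=
  [set z | forall a, dom a (base z) ->
     (component z a *m invmx (metric g a (base z)) *m (component z a)^T) 0 0 = 1].

Section Hamiltonian.
Context {R : realType} {d : nat} {M : topologicalType}.
Context {A : smooth_manifold R d M}.
Notation E := ('rV[R]_d * 'rV[R]_d)%type.
Implicit Types (a : chart A) (z : cotangent A).
Implicit Types (f h H : cotangent A -> R) (p : 'I_d -> cotangent A -> R).

Definition in_chart a f : E -> R := f \o cot_param a.

Definition smooth_cot f : Prop :=
  forall a, smooth_on (cot_codom a `&` [set y | y.2 != 0]) (in_chart a f).

Definition dx (i : 'I_d) : E := (delta_mx 0 i, 0).
Definition dxi (i : 'I_d) : E := (0, delta_mx 0 i).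

Definition poisson a f h z : R :=
  let y := cot_coord a z in
  \sum_(i < d) ('D_(dxi i) (in_chart a f) y * 'D_(dx i) (in_chart a h) y
              - 'D_(dx i) (in_chart a f) y * 'D_(dxi i) (in_chart a h) y).

Definition hamiltonian_field a f z : E :=
  let y := cot_coord a z in
  (\row_i 'D_(dxi i) (in_chart a f) y, \row_i - 'D_(dx i) (in_chart a f) y).

Definition integral_curve f (c : R -> cotangent A) : Prop :=
  forall t, [/\ punctured (c t), {for t, continuous c} &
    forall a, dom a (base (c t)) ->
      is_derive t 1 (cot_coord a \o c) (hamiltonian_field a f (c t))].

(* The time t = (t_1, ..., t_d) of the joint flow is the time-one map of the
   Hamiltonian flow of t_1 p_1 + ... + t_d p_d. *)
Definition joint_orbit p z : set (cotangent A) :=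
  [set w | exists (t : 'rV[R]_d) (c : R -> cotangent A),
    [/\ integral_curve (fun u => \sum_(j < d) t 0 j * p j u) c,
        c 0 = z & c 1 = w]].

(* dp_1 /\ ... /\ dp_d is the d-form (v_1, ..., v_d) |-> det (dp_i (v_j)). *)
Definition regular_point p z : Prop :=
  forall a, dom a (base z) -> exists v : 'I_d -> E,
    \det (\matrix_(i, j) 'd (in_chart a (p i)) (cot_coord a z) (v j)) != 0.

Definition compact_regular_points p : set (cotangent A) :=
  [set z | [/\ punctured z, regular_point p z & compact (joint_orbit p z)]].

Definition moment_map p z : 'rV[R]_d := \row_j p j z.

(* The functions are only meaningful off the zero section; properness onto the
   image is properness of punctured -> P(punctured).  The case H = p_j is that of
   the j-th coordinate function. *)
Definition completely_integrable H p : Prop :=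
  [/\ smooth_cot H /\ forall j, smooth_cot (p j),
      forall i j z a, punctured z -> dom a (base z) ->
        poisson a (p i) (p j) z = 0,
      exists G : 'rV[R]_d -> R, forall z, punctured z -> H z = G (moment_map p z)
    & forall K : set 'rV[R]_d, K `<=` moment_map p @` @punctured _ _ _ A ->
        compact K -> compact (@punctured _ _ _ A `&` moment_map p @^-1` K)].

(* The form sum_i dxi_i /\ dx_i. *)
Definition symplectic_form (v w : E) : R :=
  \sum_(i < d) (v.2 0 i * w.1 0 i - w.2 0 i * v.1 0 i).

(* Action-angle variables (theta, I), angles first, given by the inverse
   parametrization Psi, lifted from R^d / Z^d to R^d in the angles; I ranges
   over the open set B.  As Psi is symplectic it is a local diffeomorphism. *)
Record action_angle H p (B : set 'rV[R]_d) (Psi : E -> cotangent A)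
    (F : 'rV[R]_d -> R) : Prop := {
  aa_open : open B;
  aa_image_open : open (Psi @` [set y | B y.2]);
  aa_nonzero : forall y, B y.2 -> punctured (Psi y);
  aa_continuous : forall y, B y.2 -> {for y, continuous Psi};
  aa_smooth : forall a,
    smooth_on [set y | B y.2 /\ dom a (base (Psi y))] (cot_coord a \o Psi);
  aa_inj : forall y y', B y.2 -> B y'.2 ->
    (Psi y = Psi y' <->
     y.2 = y'.2 /\ exists k : 'rV[int]_d, y'.1 = y.1 + map_mx intr k);
  aa_symplectic : forall a y, B y.2 -> dom a (base (Psi y)) ->
    forall v w, symplectic_form ('d (cot_coord a \o Psi) y v)
                                ('d (cot_coord a \o Psi) y w)
                = symplectic_form v w;
  aa_orbits : forall y, B y.2 ->
    joint_orbit p (Psi y) = [set Psi (theta, y.2) | theta in [set: 'rV[R]_d]];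
  aa_F_smooth : smooth_on B F;
  aa_F : forall y, B y.2 -> H (Psi y) = F y.2
}.

Definition grad (F : 'rV[R]_d -> R) (I : 'rV[R]_d) : 'rV[R]_d :=
  \row_j 'D_(delta_mx 0 j) F I.

Definition hess (F : 'rV[R]_d -> R) (I : 'rV[R]_d) : 'M[R]_d :=
  \matrix_(j, k) 'D_(delta_mx 0 j) ('D_(delta_mx 0 k) F) I.

Definition bordered_hess (F : 'rV[R]_d -> R) (I : 'rV[R]_d) : 'M[R]_(d + 1) :=
  block_mx (hess F I) (grad F I)^T (grad F I) 0.

(* The two conditions below do not depend on the action-angle variables:
   others differ near a given torus by I' = I *m Q + c with Q in GL_d(Z). *)
Definition kolmogorov_at H p z : Prop :=
  exists (B : set 'rV[R]_d) (Psi : E -> cotangent A) (F : 'rV[R]_d -> R) (y : E),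
    [/\ action_angle H p B Psi F, B y.2, Psi y = z & \det (hess F y.2) != 0].

Definition isoenergetic_at H p z : Prop :=
  exists (B : set 'rV[R]_d) (Psi : E -> cotangent A) (F : 'rV[R]_d -> R) (y : E),
    [/\ action_angle H p B Psi F, B y.2, Psi y = z
      & \det (bordered_hess F y.2) != 0].

Definition kolmogorov_nondegenerate H p : Prop :=
  forall z, compact_regular_points p z -> kolmogorov_at H p z.

End Hamiltonian.

Definition open_dense_in (T : topologicalType) (S O : set T) : Prop :=
  (exists2 U : set T, open U & O = U `&` S) /\ S `<=` closure O.

(* Main.v *)
(* Let alpha be the Liouville form sum_i xi_i dx_i, pulled back to action-angle
   variables (theta, I) in which H = F(I), and let omega = grad F.  Euler's
   identity for H gives alpha(omega(I) d_theta) = 2 F(I), because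
   alpha(X_H) = xi . d_xi H = 2 H.  Fix I and choose v with F''(I) v = omega(I).
   As d alpha is the symplectic form, differentiating this identity in the
   direction v d_I shows that alpha(v d_I) has along the flow line
   theta + s omega(I) the constant derivative v . omega(I) - 2 F(I).  But
   alpha(v d_I) is a function on a torus, hence bounded, so that
   v . omega(I) = 2 F(I).  The bordered determinant is
   - det F''(I) * (v . omega(I)) = - 2 F(I) det F''(I), which does not vanish on
   {H = 1}: the open dense set is that of all compact regular points. *)

Require Import Defs.
From mathcomp Require Import all_boot all_order all_algebra.
From mathcomp Require Import all_classical all_reals all_analysis.

Set Implicit Arguments.
Unset Strict Implicit.
Unset Printing Implicit Defensive.

Import Order.TTheory GRing.Theory Num.Theory.
Import numFieldNormedType.Exports.

Local Open Scope classical_set_scope.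
Local Open Scope ring_scope.

(** * Directional derivatives and the symmetry of mixed second derivatives *)

Lemma is_derive_linear_comp (R : realType) (V W W' : normedModType R)
    (l : {linear W -> W'}) (f : V -> W) (x v : V) (df : W) :
  continuous l -> is_derive x v f df -> is_derive x v (l \o f) (l df).
Proof.
move=> lc [fxv <-].
have lf : (fun h : R => h^-1 *: (((l \o f) \o shift x) (h *: v) - (l \o f) x)) @ 0^'
    --> l ('D_v f x).
  rewrite (_ : (fun h => _) = l \o
      (fun h => h^-1 *: ((f \o shift x) (h *: v) - f x))); last first.
    by apply/funext => h; rewrite /= -linearB linearZ.
  by apply: cvg_comp; [exact: fxv|exact: lc].
apply: DeriveDef; first by apply/cvg_ex; exists (l ('D_v f x)).
exact: cvg_lim lf.
Qed.

Lemma is_derive_line (R : realType) (V W : normedModType R) (f : V -> W)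
    (x v : V) (s : R) (df : W) :
  is_derive (x + s *: v) v f df ->
  is_derive s 1 (fun s => f (x + s *: v)) df.
Proof.
move=> [fxv <-].
pose k (h : R) := h^-1 *: ((f \o shift (x + s *: v)) (h *: v) - f (x + s *: v)).
have E : (fun h : R => h^-1 *: (((fun s => f (x + s *: v)) \o shift s) (h *: 1) -
    f (x + s *: v))) = k.
  apply/funext => h; rewrite /k /=; congr (_ *: (f _ - _)).
  by rewrite [_%:A]mulr1 scalerDl addrCA.
by apply: DeriveDef; rewrite /derivable /derive E.
Qed.

(* Two applications of the mean value theorem to the second difference of g. *)
Lemma second_difference_mvt (R : realType) (V : normedModType R)
    (g gv gvw : V -> R) (x v w : V) (r : R) :
  0 < r ->
  (forall s t, 0 <= s <= r -> 0 <= t <= r ->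
     is_derive (x + s *: v + t *: w) v g (gv (x + s *: v + t *: w))) ->
  (forall s t, 0 <= s <= r -> 0 <= t <= r ->
     is_derive (x + s *: v + t *: w) w gv (gvw (x + s *: v + t *: w))) ->
  exists s t, [/\ 0 <= s <= r, 0 <= t <= r &
    g (x + r *: v + r *: w) - g (x + r *: v) - g (x + r *: w) + g x =
    gvw (x + s *: v + t *: w) * r * r].
Proof.
move=> r0 dg dgv; have rr : 0 <= r <= r by rewrite lexx ltW.
have r00 : 0 <= (0 : R) <= r by rewrite lexx ltW.
pose phi (s : R) := g (x + r *: w + s *: v) - g (x + s *: v).
pose dphi (s : R) := gv (x + s *: v + r *: w) - gv (x + s *: v).
have dphiE s : 0 <= s <= r -> is_derive s 1 phi (dphi s).
  move=> sr; apply: is_deriveB; apply: is_derive_line.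
    by rewrite addrAC; exact: dg.
  by have := dg s 0 sr r00; rewrite scale0r addr0.
have phic : {within `[0, r], continuous phi}.
  apply: derivable_within_continuous => s; rewrite in_itv/= => /dphiE[].
  by [].
have [|s] := @MVT_segment _ phi dphi _ _ (ltW r0) _ phic.
  by move=> s; rewrite in_itv/= => /andP[s0 sr]; apply: dphiE; rewrite !ltW.
move=> /[!in_itv]/= sr /[!subr0] phiE.
pose psi (t : R) := gv (x + s *: v + t *: w).
have dpsiE t : 0 <= t <= r -> is_derive t 1 psi (gvw (x + s *: v + t *: w)).
  by move=> tr; apply: is_derive_line; exact: dgv.
have psic : {within `[0, r], continuous psi}.
  apply: derivable_within_continuous => t; rewrite in_itv/= => /dpsiE[].
  by [].
have [|t] := @MVT_segment _ psi (fun t => gvw (x + s *: v + t *: w)) _ _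
   (ltW r0) _ psic.
  by move=> t; rewrite in_itv/= => /andP[t0 tr]; apply: dpsiE; rewrite !ltW.
move=> /[!in_itv]/= tr /[!subr0] psiE.
exists s, t; split => //; rewrite -psiE.
move: phiE; rewrite /phi /dphi /psi !scale0r !addr0 => <-.
by rewrite (addrAC x) -!addrA; congr (_ + _); rewrite opprD opprK.
Qed.

(** The second difference of [g] over the parallelogram with sides [r *: v] and [r *: w] does not
    change when [v] and [w] are exchanged. Divided by [r * r], it is a value of [gvw] and also a
    value of [gwv], both taken close to [x], and continuity at [x] makes the two limits agree. *)
Lemma mixed_derivatives (R : realType) (V : normedModType R)
    (g gv gw gvw gwv : V -> R) (x v w : V) :
  (\forall y \near x, is_derive y v g (gv y)) ->
  (\forall y \near x, is_derive y w g (gw y)) ->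
  (\forall y \near x, is_derive y w gv (gvw y)) ->
  (\forall y \near x, is_derive y v gw (gwv y)) ->
  {for x, continuous gvw} -> {for x, continuous gwv} ->
  gvw x = gwv x.
Proof.
move=> dg dg' dgv dgw cvw cwv; apply/eqP; rewrite -subr_eq0 -normr_le0.
apply/ler_addgt0Pr => e e0; rewrite add0r; have e20 : 0 < e / 2 by rewrite divr_gt0.
have N : \forall y \near x, [/\ is_derive y v g (gv y),
    is_derive y w g (gw y), is_derive y w gv (gvw y),
    is_derive y v gw (gwv y) & `|gvw x - gvw y| < e / 2 /\
    `|gwv x - gwv y| < e / 2].
  have /cvgrPdist_lt/(_ _ e20) A := cvw.
  have /cvgrPdist_lt/(_ _ e20) B := cwv.
  near=> y; split; [near: y; exact: dg|near: y; exact: dg'|near: y; exact: dgv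
    |near: y; exact: dgw|split; near: y; [exact: A|exact: B]].
have /nbhs_ballP[d /= d0 dN] := N.
(* As [r * K = d / 2], the whole parallelogram lies in the ball of radius [d]; the summand 1 keeps
   [K] positive when [v] and [w] are both 0. *)
pose K := `|v| + `|w| + 1; have K0 : 0 < K by rewrite ltr_wpDl// addr_ge0.
pose r := d / 2 / K; have r0 : 0 < r by rewrite !divr_gt0.
have Nr s t : 0 <= s <= r -> 0 <= t <= r -> ball x d (x + s *: v + t *: w).
  move=> /andP[s0 sr] /andP[t0 tr]; rewrite -ball_normE /= -addrA opprD addNKr.
  rewrite normrN (le_lt_trans (ler_normD _ _))// !normrZ !ger0_norm//.
  rewrite (@le_lt_trans _ _ (r * K))//; last first.
    by rewrite /r divfK ?gt_eqF// ltr_pdivrMr// ltr_pMr// ltr1n.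
  rewrite /K !mulrDr mulr1 (@le_trans _ _ (r * `|v| + r * `|w|))//.
    by rewrite lerD// ler_wpM2r.
  by rewrite lerDl ltW.
have [s [t [sr tr E]]] := second_difference_mvt r0
  (fun s t hs ht => let: And5 h _ _ _ _ := dN _ (Nr s t hs ht) in h)
  (fun s t hs ht => let: And5 _ _ h _ _ := dN _ (Nr s t hs ht) in h).
have Nr' s0 t0 : 0 <= s0 <= r -> 0 <= t0 <= r -> ball x d (x + s0 *: w + t0 *: v).
  by move=> *; rewrite addrAC; exact: Nr.
have [s' [t' [sr' tr' E']]] := second_difference_mvt r0
  (fun s t hs ht => let: And5 _ h _ _ _ := dN _ (Nr' s t hs ht) in h)
  (fun s t hs ht => let: And5 _ _ _ h _ := dN _ (Nr' s t hs ht) in h).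
have {E E'} : gvw (x + s *: v + t *: w) = gwv (x + s' *: w + t' *: v).
  apply: (mulIf (lt0r_neq0 r0)); apply: (mulIf (lt0r_neq0 r0)).
  by rewrite -E -E' (addrAC x) [X in X + _](addrAC _ (- _) (- _)).
have [_ _ _ _ [+ _]] := dN _ (Nr _ _ sr tr).
have [_ _ _ _ [_ +]] := dN _ (Nr' _ _ sr' tr').
move: (gvw (_ + _)) (gwv (_ + _)) => a b + + ab; rewrite -{}ab distrC => h1 h2.
rewrite -(subrKA a) (le_trans (ler_normD _ _))// (splitr e) lerD// ltW//.
Unshelve. all: by end_near. Qed.

(** * Symplectic linear algebra and the exterior derivative of the Liouville form *)

Section PhaseSpace.
Context {R : realType} {d : nat}.
Notation E := ('rV[R]_d * 'rV[R]_d)%type.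

(** The form is non-degenerate: a vector of the kernel of [L] is orthogonal to everything, and
    pairing it with the basis vectors reads off its coordinates up to sign. *)
Lemma symplectic_form_injective (L : {linear E -> E}) :
  (forall v w, symplectic_form (L v) (L w) = symplectic_form v w) ->
  injective L.
Proof.
move=> Lsym; apply: raddf_inj => v Lv0.
have v0 w : symplectic_form v w = 0.
  rewrite -Lsym Lv0 /symplectic_form big1// => i _ /=.
  by rewrite !mxE mul0r mulr0 subrr.
case: v v0 {Lv0} => v1 v2 v0; congr (_, _); apply/rowP => i; rewrite mxE.
  have := v0 (0, delta_mx 0 i); rewrite /symplectic_form (bigD1 i)//= big1.
    by rewrite !mxE !eqxx mulr0 mul1r sub0r addr0 => /eqP; rewrite oppr_eq0 => /eqP.
  by move=> j ji; rewrite !mxE eqxx (negbTE ji) mulr0 mul0r subrr.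
have := v0 (delta_mx 0 i, 0); rewrite /symplectic_form (bigD1 i)//= big1.
  by rewrite !mxE !eqxx mulr1 mul0r subr0 addr0.
by move=> j ji; rewrite !mxE eqxx (negbTE ji) mulr0 mul0r subrr.
Qed.

(** An injective endomorphism of a finite-dimensional space is onto. This later lifts the fibre
    direction to action-angle variables. *)
Lemma symplectic_form_surjective (L : {linear E -> E}) (e : E) :
  (forall v w, symplectic_form (L v) (L w) = symplectic_form v w) ->
  exists w, L w = e.
Proof.
move=> /symplectic_form_injective Linj.
pose f : 'End(E) := linfun L.
have kerf : lker f == 0%VS.
  by apply/lker0P => x y; rewrite !lfunE; exact: Linj.
by exists ((f^-1)%VF e); rewrite -[L _]lfunE -/f lker0_lfunVK.
Qed.

Section Liouville.
Context {V : normedModType R}.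
Implicit Types (f : V -> E) (U : set V).

Lemma is_derive_fst f i (y v : V) df :
  is_derive y v f df -> is_derive y v (fun z => (f z).1 0 i) (df.1 0 i).
Proof.
move=> fv.
have fstc : continuous (fst : E -> 'rV[R]_d) by move=> x; exact: cvg_fst.
have H1 : is_derive y v (fun z => (f z).1) df.1 := is_derive_linear_comp fstc fv.
have [H2 <-] := H1; have := (derivable_mxP _ _ _).1 H2 0 i => /derivableP.
by rewrite (derive_mx H2) mxE.
Qed.

Lemma is_derive_snd f i (y v : V) df :
  is_derive y v f df -> is_derive y v (fun z => (f z).2 0 i) (df.2 0 i).
Proof.
move=> fv.
have sndc : continuous (snd : E -> 'rV[R]_d) by move=> x; exact: cvg_snd.
have H1 : is_derive y v (fun z => (f z).2) df.2 := is_derive_linear_comp sndc fv.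
have [H2 <-] := H1; have := (derivable_mxP _ _ _).1 H2 0 i => /derivableP.
by rewrite (derive_mx H2) mxE.
Qed.

(* The pullback by f of the form sum_i xi_i dx_i, evaluated at y on the constant
   vector field w. *)
Definition liouville f (w y : V) : R :=
  \sum_(i < d) (f y).2 0 i * ('D_w f y).1 0 i.

Lemma is_derive_liouville f (v w y : V) fv fwv :
  is_derive y v f fv -> is_derive y v ('D_w f) fwv ->
  is_derive y v (liouville f w)
    (\sum_(i < d) ((f y).2 0 i * fwv.1 0 i + ('D_w f y).1 0 i * fv.2 0 i)).
Proof.
move=> df dfw.
rewrite (_ : liouville f w =
  \sum_(i < d) ((fun z => (f z).2 0 i) * (fun z => ('D_w f z).1 0 i))).
  apply: is_derive_sum => i; apply: is_deriveM.
    exact: is_derive_snd.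
  exact: is_derive_fst.
by apply/funext => z; rewrite fct_sumE.
Qed.

(** The statement is about position components because these are the ones that get differentiated
    twice in the derivative of [liouville]. *)
Lemma Ck_derive_swap f U (v w y : V) : open U -> Ck_on 2 U f -> U y ->
  forall i, ('D_v ('D_w f) y).1 0 i = ('D_w ('D_v f) y).1 0 i.
Proof.
move=> oU [df Cf] Uy i.
have Uy' : \forall z \near y, U z by apply: open_nbhs_nbhs.
have cD (v' w' : V) : {for y, continuous (fun z => ('D_v' ('D_w' f) z).1 0 i)}.
  have [_ /(_ v')/(_ _ Uy) c] := Cf w'.
  apply: (@continuous_comp _ _ _ _ (fun e : E => e.1 0 i) y c).
  apply: (@continuous_comp _ _ _ fst (fun m : 'rV[R]_d => m 0 i)).
    exact: cvg_fst.
  exact: coord_continuous.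
apply: (@mixed_derivatives _ _ (fun z => (f z).1 0 i)
  (fun z => ('D_w f z).1 0 i) (fun z => ('D_v f z).1 0 i)
  (fun z => ('D_v ('D_w f) z).1 0 i) (fun z => ('D_w ('D_v f) z).1 0 i) y w v).
- apply: filterS Uy' => z Uz; apply: is_derive_fst.
  exact/derivableP/diff_derivable/df.
- apply: filterS Uy' => z Uz; apply: is_derive_fst.
  exact/derivableP/diff_derivable/df.
- apply: filterS Uy' => z Uz; apply: is_derive_fst.
  by apply/derivableP/diff_derivable; apply: (Cf w).1.
- apply: filterS Uy' => z Uz; apply: is_derive_fst.
  by apply/derivableP/diff_derivable; apply: (Cf v).1.
- exact: cD.
- exact: cD.
Qed.

Lemma differentiable_liouville f (w y : V) :
  differentiable f y -> differentiable ('D_w f) y ->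
  differentiable (liouville f w) y.
Proof.
move=> df dfw.
have fst_diff (g : V -> E) i : differentiable g y ->
    differentiable (fun z => (g z).1 0 i) y.
  move=> dg; apply: (@differentiable_comp _ _ _ _ (fst \o g)
    (fun m : 'rV[R]_d => m 0 i)); last exact: differentiable_coord.
  apply: differentiable_comp => //; apply: linear_differentiable => x.
  exact: cvg_fst.
have snd_diff (g : V -> E) i : differentiable g y ->
    differentiable (fun z => (g z).2 0 i) y.
  move=> dg; apply: (@differentiable_comp _ _ _ _ (snd \o g)
    (fun m : 'rV[R]_d => m 0 i)); last exact: differentiable_coord.
  apply: differentiable_comp => //; apply: linear_differentiable => x.
  exact: cvg_snd.
rewrite (_ : liouville f w =
  \sum_(i < d) ((fun z => (f z).2 0 i) * (fun z => ('D_w f z).1 0 i))).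
  apply: differentiable_sum => i; apply: differentiableM.
    exact: snd_diff.
  exact: fst_diff.
by apply/funext => z; rewrite fct_sumE.
Qed.

Let liouville_antisymmetrized (x fv fw fvw fwv : E) :
  (forall i, fvw.1 0 i = fwv.1 0 i) ->
  \sum_(i < d) (x.2 0 i * fvw.1 0 i + fw.1 0 i * fv.2 0 i) -
  \sum_(i < d) (x.2 0 i * fwv.1 0 i + fv.1 0 i * fw.2 0 i) =
  symplectic_form fv fw.
Proof.
move=> e; rewrite -sumrB; apply: eq_bigr => i _.
by rewrite e opprD addrACA subrr add0r (mulrC (fw.1 0 i)) (mulrC (fv.1 0 i)).
Qed.

(** The left side is the exterior derivative of the pulled back form on the constant fields [v] and
    [w], whose bracket vanishes. The mixed second derivatives cancel, and what remains is the
    pullback of the symplectic form. *)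
Lemma exterior_derivative_liouville f U (v w y : V) :
  open U -> Ck_on 2 U f -> U y ->
  'D_v (liouville f w) y - 'D_w (liouville f v) y =
  symplectic_form ('D_v f y) ('D_w f y).
Proof.
move=> oU Cf Uy; have [df Cf1] := Cf.
have Df v' : is_derive y v' f ('D_v' f y) by exact/derivableP/diff_derivable/df.
have DDf v' w' : is_derive y v' ('D_w' f) ('D_v' ('D_w' f) y).
  exact/derivableP/diff_derivable/(Cf1 _).1.
have [_ Dvw] := is_derive_liouville (Df v) (DDf v w).
have [_ Dwv] := is_derive_liouville (Df w) (DDf w v).
apply: (etrans (congr2 (fun a b => a - b) Dvw Dwv)).
exact: liouville_antisymmetrized (Ck_derive_swap v w oU Cf Uy).
Qed.

Lemma liouville_sum f (y : V) n (c : 'I_n -> R) (w : 'I_n -> V) :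
  differentiable f y ->
  liouville f (\sum_j c j *: w j) y = \sum_j c j * liouville f (w j) y.
Proof.
move=> df; pose l (e : E) := \sum_(i < d) (f y).2 0 i * e.1 0 i.
have lE v : liouville f v y = l ('d f y v) by rewrite -deriveE.
apply: etrans (lE _) _; transitivity (\sum_j c j * l ('d f y (w j))); last first.
  by apply: eq_bigr => j _; congr (_ * _); exact/esym/lE.
move: ('d f y) => D; rewrite /l.
under [RHS]eq_bigr do rewrite mulr_sumr.
rewrite exchange_big /=; apply: eq_bigr => i _.
rewrite linear_sum raddf_sum summxE mulr_sumr; apply: eq_bigr => j _.
by rewrite linearZ /= mxE mulrCA.
Qed.

End Liouville.
End PhaseSpace.

(** * Covectors in charts: Euler's identity and invariance of the Liouville form *)

Section CotangentCoordinates.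
Context {R : realType} {d : nat} {M : topologicalType}.
Context {A : smooth_manifold R d M}.
Notation E := ('rV[R]_d * 'rV[R]_d)%type.
Implicit Types (a b : chart A) (z w : cotangent A).

Lemma cotangent_eq z w :
  base z = base w -> component z = component w -> z = w.
Proof.
case: z w => [m c o h] [m' c' o' h'] /= mm' cc'.
case: _ / mm' o' h'; case: _ / cc' => o' h'.
by rewrite (Prop_irrelevance o o') (Prop_irrelevance h h').
Qed.

Lemma cot_coordK a z : dom a (base z) -> cot_param a (cot_coord a z) = z.
Proof.
move=> az; apply: cotangent_eq; first by rewrite /= coordK.
apply/funext => b /=; rewrite /cot_comp coordK//.
by case: asboolP => [[_ bz]|nab];
  [rewrite -comp_change|rewrite comp_out// => bz; apply: nab].
Qed.

Lemma cot_scaleE a l z : dom a (base z) ->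
  cot_scale l z = cot_param a (Defs.coord a (base z), l *: component z a).
Proof.
move=> az; apply: cotangent_eq; first by rewrite /= coordK.
apply/funext => b /=; rewrite /cot_comp coordK//; case: asboolP => [[_ bz]|nab].
  by rewrite -scalemxAl -comp_change.
by rewrite comp_out ?scaler0// => bz; apply: nab.
Qed.

Lemma open_cot_dom a : open (@cot_dom R d M A a).
Proof.
rewrite -[open _]/(cot_open (cot_dom a)) => b.
rewrite (_ : _ `&` _ =
    (fst : E -> 'rV[R]_d) @^-1` (chart_image b `&` param b @^-1` dom a))//.
apply: open_comp; first by move=> x _; exact: cvg_fst.
rewrite openE => y [iy ay]; apply: filterI.
  by apply: open_nbhs_nbhs; split => //; exact: chart_image_open.
apply: (param_continuous iy); apply: open_nbhs_nbhs; split => //.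
exact: dom_open.
Qed.

Lemma punctured_component a z : punctured z -> dom a (base z) ->
  component z a != 0.
Proof.
move=> [b zb0] az; apply: contra_neq zb0 => za0.
have [bz|/comp_out//] := pselect (dom b (base z)).
by rewrite (comp_change bz az) za0 mul0mx.
Qed.

Lemma in_chart_differentiable (H : cotangent A -> R) a z : smooth_cot H ->
  punctured z -> dom a (base z) -> differentiable (in_chart a H) (cot_coord a z).
Proof.
move=> Hs pz az; have [+ _] := Hs a 1%N; apply; split => /=.
  by exists (base z).
exact: punctured_component.
Qed.

(** Moving from [z] by [s] in the fibre direction [component z a] scales the covector by [1 + s], so
    that [H] becomes [(1 + s) ^+ 2 * H z], whose derivative at 0 is [2 * H z]. *)
Lemma euler_homogeneous2 (H : cotangent A -> R) a z : smooth_cot H ->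
  (forall l z, 0 < l -> punctured z -> H (cot_scale l z) = l ^+ 2 * H z) ->
  punctured z -> dom a (base z) ->
  'D_(0, component z a) (in_chart a H) (cot_coord a z) = 2 * H z.
Proof.
move=> Hs Hh pz az; set v := (0, _); set y := cot_coord a z.
have dh : is_derive (y + 0 *: v) v (in_chart a H) ('D_v (in_chart a H) y).
  by rewrite scale0r addr0; apply/derivableP/diff_derivable/in_chart_differentiable.
have [_ <-] := is_derive_line dh.
have E1 : \forall s \near (0 : R),
    in_chart a H (y + s *: v) = (1 + s) ^+ 2 * H z.
  (* Homogeneity applies to positive factors, that is, to [s > -1]. *)
  have : \forall s \near (0 : R), - 1 < s by apply: lt_nbhsr; rewrite ltrN10.
  apply: filterS => s s1; rewrite -Hh//; last by rewrite -ltrBlDl sub0r.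
  rewrite (cot_scaleE _ az) /in_chart /= /y /v; congr (H (cot_param a _)).
  by congr (_, _) => /=; rewrite ?scaler0 ?addr0// scalerDl scale1r.
rewrite (near_eq_derive _ E1).
pose q (s : R) : R := 1 + s.
have D1 : is_derive (0 : R) (1 : R) q 1.
  by rewrite -[1 in X in is_derive _ _ _ X]add0r; exact: is_deriveD.
have D2 : is_derive (0 : R) (1 : R) (q * q * cst (H z))
    ((q * q) 0 *: (0 : R) + H z *: (q 0 *: (1 : R) + q 0 *: (1 : R))).
  exact: is_deriveM.
have [_ ->] := D2.
by rewrite scaler0 add0r /q addr0 !scale1r mulrC.
Qed.

(** With [J] the Jacobian of the change of chart, velocities of the base point transform by
    [v_b = v_a *m J] and covectors by [xi_a = xi_b *m J^T], so the pairing of the two is the same in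
    both charts. *)
Lemma liouville_chart_change (V : normedModType R) (Psi : V -> cotangent A)
    a b (w y : V) :
  (\forall y' \near y, dom a (base (Psi y')) /\ dom b (base (Psi y'))) ->
  differentiable (cot_coord a \o Psi) y -> differentiable (cot_coord b \o Psi) y ->
  liouville (cot_coord a \o Psi) w y = liouville (cot_coord b \o Psi) w y.
Proof.
move=> ab da db.
have liouE c : liouville (cot_coord c \o Psi) w y =
    (component (Psi y) c *m ('D_w (cot_coord c \o Psi) y).1^T) 0 0.
  by rewrite /liouville mxE; apply: eq_bigr => i _; rewrite mxE.
have [ay by_] := nbhs_singleton ab.
have fstc : continuous (fst : E -> 'rV[R]_d) by move=> x; exact: cvg_fst.
pose x c := fst \o (cot_coord c \o Psi).
have dx c : differentiable (cot_coord c \o Psi) y -> differentiable (x c) y.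
  by move=> ?; apply: differentiable_comp => //; exact: linear_differentiable.
have DxE c : differentiable (cot_coord c \o Psi) y ->
    'D_w (x c) y = ('D_w (cot_coord c \o Psi) y).1.
  move=> dc; have D := derivableP (diff_derivable dc).
  by have [] := is_derive_linear_comp fstc (D w).
have xbE : \forall y' \near y, x b y' = ((Defs.coord b \o param a) \o x a) y'.
  by apply: filterS ab => y' [ay' _]; rewrite /x /= coordK.
have dT := transition_differentiable ay by_.
have chain : 'D_w ((Defs.coord b \o param a) \o x a) y =
    'D_w (x a) y *m change_jac a b (base (Psi y)).
  rewrite mul_jacobian.
  apply: etrans (deriveE w (differentiable_comp (dx a da) dT)) _.
  apply: etrans (congr1 (fun D : _ -> _ => D w) (diff_comp (dx a da) dT)) _.
  exact/(congr1 ('d (Defs.coord b \o param a) (x a y)))/esym/deriveE/dx.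
have E1 : ('D_w (cot_coord b \o Psi) y).1 =
    ('D_w (cot_coord a \o Psi) y).1 *m change_jac a b (base (Psi y)).
  apply: etrans (esym (DxE b db)) _; apply: etrans (near_eq_derive w xbE) _.
  exact: etrans chain (congr1 (mulmx^~ _) (DxE a da)).
apply: etrans (liouE a) (etrans _ (esym (liouE b))).
apply: etrans (esym (congr1 (fun u => (component (Psi y) b *m u^T) 0 0) E1)).
by rewrite trmx_mul mulmxA -(comp_change ay by_).
Qed.

End CotangentCoordinates.

(** * The Liouville form in action-angle variables *)

Lemma is_derive_snd_comp (R : realType) (V V' W : normedModType R) (G : V' -> W)
    (y w : V * V') (dG : W) :
  is_derive y.2 w.2 G dG -> is_derive y w (fun z => G z.2) dG.
Proof. by case. Qed.

Section ActionAngle.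
Context {R : realType} {d : nat} {M : topologicalType}.
Context {A : smooth_manifold R d M}.
Notation E := ('rV[R]_d * 'rV[R]_d)%type.

Lemma sum_dx (c : 'rV[R]_d) : (c, 0) = \sum_j c 0 j *: dx j :> E.
Proof.
rewrite [RHS]surjective_pairing !raddf_sum /= {1}(row_sum_delta c).
by congr (_, _); rewrite big1// => j _; rewrite scaler0.
Qed.

Lemma derive_grad (F : 'rV[R]_d -> R) (I v : 'rV[R]_d) : differentiable F I ->
  'D_v F I = \sum_j v 0 j * grad F I 0 j.
Proof.
move=> dF; apply: etrans (deriveE v dF) _.
rewrite {1}(row_sum_delta v) linear_sum; apply: eq_bigr => j _.
by rewrite linearZ mxE deriveE.
Qed.

Variables (H : cotangent A -> R) (p : 'I_d -> cotangent A -> R).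
Variables (B : set 'rV[R]_d) (Psi : E -> cotangent A) (F : 'rV[R]_d -> R).
Hypothesis aa : action_angle H p B Psi F.
Hypothesis H_smooth : smooth_cot H.
Hypothesis H_homogeneous : forall l z, 0 < l -> punctured z ->
  H (cot_scale l z) = l ^+ 2 * H z.

Let U (a : chart A) : set E := [set y | B y.2 /\ dom a (base (Psi y))].
Let f (a : chart A) : E -> E := cot_coord a \o Psi.

Let openU a : open (U a).
Proof.
rewrite openE => y [By ay]; apply: filterI.
  apply: (@cvg_snd _ _ (nbhs y.1) (nbhs y.2)); apply: open_nbhs_nbhs.
  by split => //; exact: aa_open aa.
have : nbhs (Psi y) (cot_dom a).
  by apply: open_nbhs_nbhs; split; [exact: open_cot_dom|].
exact: (aa_continuous aa By).
Qed.

Let row0E (i : 'I_d) : (0 : 'rV[R]_d) 0 i = 0. Proof. exact: mxE. Qed.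

Let nearU a y : U a y -> \forall y' \near y, U a y'.
Proof. by move=> Uy; apply: open_nbhs_nbhs; split; [exact: openU|]. Qed.

Let fC2 a : Ck_on 2 (U a) (f a). Proof. exact: (aa_smooth aa a 2%N). Qed.

Let f_diff a y : U a y -> differentiable (f a) y.
Proof. by move=> Uy; have [+ _] := fC2 a; apply. Qed.

Let liou_diff a w y : U a y -> differentiable (liouville (f a) w) y.
Proof.
move=> Uy; apply: differentiable_liouville; first exact: f_diff.
by have [_ /(_ w)[+ _]] := fC2 a; apply.
Qed.

Let F_diff I : B I -> differentiable F I.
Proof. by move=> BI; have [+ _] := aa_F_smooth aa 1%N; apply. Qed.

(** Let [w] be the vector that the differential of [Psi] sends to the fibre direction [(0, xi)].
    Pairing [w] with [(grad F, 0)] before and after this symplectic map identifies the left side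
    with the derivative of [F] along [w.2]. That is the derivative of [H] in the fibre direction,
    which Euler's identity evaluates. *)
Lemma action_angle_euler a y : U a y ->
  liouville (f a) (grad F y.2, 0) y = 2 * F y.2.
Proof.
move=> Uy; have [By ay] := Uy.
have df := f_diff Uy.
have pz : punctured (Psi y) := aa_nonzero aa By.
have dh : differentiable (in_chart a H) (f a y).
  exact: in_chart_differentiable.
have [w Dw] := symplectic_form_surjective (0, component (Psi y) a)
  (aa_symplectic aa By ay).
have hfE : \forall y' \near y, (in_chart a H \o f a) y' = F y'.2.
  apply: filterS (nearU Uy) => y' [By' ay'].
  by rewrite /= /in_chart /= cot_coordK// (aa_F aa).
have D1 : 'D_w (in_chart a H \o f a) y = 2 * F y.2.
  apply: etrans (deriveE w (differentiable_comp df dh)) _.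
  apply: etrans (congr1 (fun D : _ -> _ => D w) (diff_comp df dh)) _.
  apply: etrans (congr1 ('d (in_chart a H) (f a y)) Dw) _.
  apply: etrans (esym (deriveE _ dh)) _.
  by apply: etrans (euler_homogeneous2 H_smooth H_homogeneous pz ay) _; rewrite (aa_F aa).
have D2 : 'D_w (in_chart a H \o f a) y = \sum_j w.2 0 j * grad F y.2 0 j.
  apply: etrans (near_eq_derive w hfE) _.
  have [_ +] := is_derive_snd_comp (derivableP (@diff_derivable _ _ _ F y.2 w.2 (F_diff By))).
  by move=> D; apply: etrans D _; apply: derive_grad; exact: F_diff.
apply: etrans _ D1; apply: etrans _ (esym D2).
have := aa_symplectic aa By ay w (grad F y.2, 0); rewrite Dw.
have -> : 'd (cot_coord a \o Psi) y (grad F y.2, 0) = 'D_(grad F y.2, 0) (f a) y.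
  exact/esym/deriveE.
rewrite /symplectic_form /= => S; apply: etrans (etrans S _).
  by rewrite /liouville; apply: eq_bigr => i _; rewrite row0E mulr0 subr0.
by apply: eq_bigr => i _; rewrite row0E mul0r subr0.
Qed.

Lemma liouville_variation a y v : U a y -> v *m hess F y.2 = grad F y.2 ->
  'D_(grad F y.2, 0) (liouville (f a) (0, v)) y =
  \sum_j v 0 j * grad F y.2 0 j - 2 * F y.2.
Proof.
move=> Uy vhess; have [By ay] := Uy; have df := f_diff Uy.
set I := y.2 in vhess *; pose w : E := (0, v).
pose L (j : 'I_d) := liouville (f a) (dx j).
have LE c y' : U a y' -> liouville (f a) (c, 0) y' = \sum_j c 0 j * L j y'.
  move=> Uy'; rewrite -liouville_sum; last exact: f_diff.
  by rewrite -sum_dx.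
have DL j : is_derive y w (L j) ('D_w (L j) y).
  exact/derivableP/diff_derivable/liou_diff.
(* By the choice of [v], the frequency vector is its own derivative in the direction [v]. *)
have Dgrad j : is_derive y w (fun z => grad F z.2 0 j) (grad F I 0 j).
  apply: (@is_derive_snd_comp _ _ _ _ (fun I => grad F I 0 j)).
  rewrite (_ : (fun I => _) = 'D_(delta_mx 0 j) F); last first.
    by apply/funext => I'; rewrite mxE.
  have dDF : differentiable ('D_(delta_mx 0 j) F) I.
    by have [_ /(_ (delta_mx 0 j))[+ _]] := aa_F_smooth aa 2%N; apply.
  apply: DeriveDef; first exact: diff_derivable.
  rewrite (derive_grad _ dDF) -vhess mxE; apply: eq_bigr => k _.
  by rewrite !mxE.
have DF : is_derive y w (fun z => 2 * F z.2) (2 * \sum_j v 0 j * grad F I 0 j).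
  apply: (@is_derive_snd_comp _ _ _ _ (fun I => 2 * F I)).
  rewrite -derive_grad; last exact: F_diff.
  exact/is_deriveZ/derivableP/diff_derivable/F_diff.
have eulerE : \forall y' \near y, \sum_j grad F y'.2 0 j * L j y' = 2 * F y'.2.
  by apply: filterS (nearU Uy) => y' Uy'; rewrite -LE//; exact: action_angle_euler.
have D1 : is_derive y w (fun z => \sum_j grad F z.2 0 j * L j z)
    (\sum_j (grad F I 0 j * 'D_w (L j) y + L j y * grad F I 0 j)).
  rewrite (_ : (fun z => _) =
      \sum_j ((fun z : E => grad F z.2 0 j) * L j)); last first.
    by apply/funext => z; rewrite fct_sumE.
  by apply: is_derive_sum => j; apply: is_deriveM.
(* Here the coefficients stay at [I], whereas [D1] also differentiates them; the extra sum in [D1]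
   is the Liouville form on the frequency vector, hence [2 * F I]. *)
have D2 : 'D_w (liouville (f a) (grad F I, 0)) y =
    \sum_j grad F I 0 j * 'D_w (L j) y.
  have E1 : \forall y' \near y, liouville (f a) (grad F I, 0) y' =
      (\sum_j grad F I 0 j *: L j) y'.
    by apply: filterS (nearU Uy) => y' Uy'; rewrite LE// fct_sumE.
  apply: etrans (near_eq_derive w E1) _.
  have := is_derive_sum (fun j => is_deriveZ (grad F I 0 j) (DL j)).
  by case.
have D3 : \sum_j grad F I 0 j * 'D_w (L j) y + 2 * F I =
    2 * \sum_j v 0 j * grad F I 0 j.
  have [_ <-] := DF; apply: etrans _ (near_eq_derive w eulerE).
  have [_ D1E] := D1; apply: etrans _ (esym D1E).
  have e2F : \sum_j grad F I 0 j * L j y = 2 * F I.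
    exact: etrans (esym (LE _ _ Uy)) (action_angle_euler Uy).
  rewrite big_split /= -e2F.
  by congr (_ + _); apply: eq_bigr => j _; rewrite mulrC.
have := exterior_derivative_liouville w (grad F I, 0) (@openU a) (@fC2 a) Uy.
have -> : symplectic_form ('D_w (f a) y) ('D_(grad F I, 0) (f a) y) =
    \sum_j v 0 j * grad F I 0 j.
  apply: etrans (congr2 _ (deriveE _ df) (deriveE _ df)) _.
  apply: etrans (aa_symplectic aa By ay _ _) _.
  by apply: eq_bigr => i _; rewrite /= row0E mul0r subr0.
move/(congr1 (fun r => 'D_w (liouville (f a) (grad F I, 0)) y - r)).
rewrite subKr => ->.
apply: etrans (congr1 (fun r => r - _) D2) _.
apply: (addIr (2 * F I)); rewrite addrAC D3 subrK.
by rewrite mulr_natl mulr2n addrK.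
Qed.

Let some_chart (z : cotangent A) : chart A :=
  sval (cid (@dom_cover _ _ _ A (base z))).

(* Read in an arbitrary chart, the pulled back form is nevertheless a continuous
   function on all of the torus, by liouville_chart_change. *)
Let liou (w y : E) : R := liouville (f (some_chart (Psi y))) w y.

Let liouE a w y : U a y -> liou w y = liouville (f a) w y.
Proof.
move=> Uy; have [By ay] := Uy; rewrite /liou; set b := some_chart _.
have Uby : U b y by split => //; rewrite /b /some_chart; case: cid.
apply: liouville_chart_change; [|exact: f_diff|exact: f_diff].
have Ub := nearU Uby.
by apply: filterS2 (nearU Uy) Ub => y' [_ ay'] [_ by'].
Qed.

Let near_liouE a w y : U a y ->
  \forall y' \near y, liouville (f a) w y' = liou w y'.
Proof. by move=> Uy; apply: filterS (nearU Uy) => y' ?; rewrite (@liouE a). Qed.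

Let U_cover y : B y.2 -> exists a, U a y.
Proof. by move=> By; have [a ay] := @dom_cover _ _ _ A (base (Psi y)); exists a. Qed.

Let liou_continuous w y : B y.2 -> {for y, continuous (liou w)}.
Proof.
move=> /U_cover[a Uy].
have := differentiable_continuous (liou_diff w Uy).
rewrite /prop_for /continuous_at (liouE w Uy) => c.
apply: cvg_trans c; apply: near_eq_cvg.
by apply: filterS (near_liouE w Uy) => y'.
Qed.

(** [Psi] is invariant under integer translations of the angles, hence so are its derivatives. *)
Let liou_periodic w y (k : 'rV[int]_d) : B y.2 ->
  liou w (y + (map_mx intr k, 0)) = liou w y.
Proof.
move=> By; set s : E := (_, 0).
have shiftE y' : B y'.2 -> Psi (y' + s) = Psi y'.
  move=> By'; apply/esym/(aa_inj aa) => //=; first by rewrite addr0.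
  by split; [rewrite addr0|exists k].
have [a Uy] := U_cover By; have [_ ay] := Uy.
have Uys : U a (y + s) by split; rewrite ?shiftE//= addr0.
transitivity (liouville (f a) w (y + s)); first exact: liouE.
transitivity (liouville (f a) w y); last by apply/esym; exact: liouE.
have DE : 'D_w (f a) (y + s) = 'D_w (f a) y.
  have e : \forall y' \near y, f a (y' + s) = f a y'.
    by apply: filterS (nearU Uy) => y' [By' _]; rewrite /f /= shiftE.
  apply: etrans _ (near_eq_derive w e).
  rewrite /derive; congr (lim (_ @ 0^')); apply/funext => h /=.
  by rewrite addrA.
by rewrite /liouville DE /f /= shiftE.
Qed.

(** A continuous function attains a maximum on the unit cube, and subtracting integer parts brings
    every angle vector into this cube. *)
Let liou_bounded w I : B I -> exists C, forall theta, `|liou w (theta, I)| <= C.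
Proof.
move=> BI; pose g theta := `|liou w (theta, I)|.
have gc : continuous g.
  move=> theta; apply: (@continuous_comp _ _ _ (fun t => liou w (t, I))).
    apply: (@continuous_comp _ _ _ (fun t => (t, I)) (liou w)).
      apply: differentiable_continuous.
      exact: (@differentiable_pair _ _ _ _ id (cst I)).
    exact: (@liou_continuous w (theta, I) BI).
  exact: norm_continuous.
pose K := [set v : 'rV[R]_d | forall i, `[0, 1]%classic (v ord0 i)].
have cK : compact K.
  by have := @rV_compact R d (fun=> `[0, 1]%classic) (fun=> @segment_compact _ _ _).
have [|c _ cmax] := EVT_max_rV _ cK (continuous_subspaceT gc).
  by exists 0 => i /=; rewrite mxE in_itv /= lexx ler01.
exists (g c) => theta.
pose k : 'rV[int]_d := \row_i Num.floor (theta 0 i).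
pose theta' := theta - map_mx intr k.
have thetaE : (theta, I) = (theta', I) + (map_mx intr k, 0) :> E.
  by congr (_, _); rewrite /= ?addr0 ?subrK.
have e : `|liou w (theta, I)| = g theta'.
  by rewrite thetaE; apply: congr1; exact: (@liou_periodic w (theta', I)).
rewrite [leLHS]e; apply: cmax; rewrite inE /K /= => i.
rewrite !mxE in_itv /= subr_ge0 lerBlDr.
have /andP[-> /ltW] := floor_itv (theta 0 i).
by rewrite intrD addrC.
Qed.

(** A bounded function on a line cannot have a non-zero constant derivative. The line is the lifted
    flow line in the direction [grad F I], and the derivative is [kappa]. *)
Lemma hessian_quadratic_form I v : B I -> v *m hess F I = grad F I ->
  \sum_j v 0 j * grad F I 0 j = 2 * F I.
Proof.
move=> BI vhess; apply/eqP; rewrite -subr_eq0; set kappa := _ - _.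
have [C Cmax] := liou_bounded (0, v) BI.
have liouD theta : is_derive (theta, I) (grad F I, 0) (liou (0, v)) kappa.
  have [a Uy] := @U_cover (theta, I) BI.
  apply: near_eq_is_derive (near_liouE (0, v) Uy) _; apply: DeriveDef.
    exact/diff_derivable/liou_diff.
  exact: liouville_variation.
pose phi (s : R) := liou (0, v) ((0, I) + s *: (grad F I, 0)).
have phiE (s : R) : is_derive s 1 phi kappa.
  apply: is_derive_line; rewrite (_ : _ + _ = (s *: grad F I, I))//.
  by congr (_, _); rewrite /= ?scaler0 ?add0r ?addr0.
have phi_bounded s : `|phi s| <= C.
  rewrite /phi (_ : _ + _ = (s *: grad F I, I)) ?Cmax//.
  by congr (_, _); rewrite /= ?scaler0 ?add0r ?addr0.
apply: contraT => kappa0.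
(* Over this time [phi] would change by exactly [2 * C + 1] in absolute value, more than the bound
   [C] permits. *)
pose s := (2 * C + 1) / `|kappa|.
have C0 : 0 <= C := le_trans (normr_ge0 _) (phi_bounded 0).
have s0 : 0 < s by rewrite divr_gt0 ?normr_gt0// ltr_wpDl// mulr_ge0.
have phic : {within `[0, s], continuous phi}.
  by apply: derivable_within_continuous => t _; have [] := phiE t.
have [t _ phiE'] := @MVT_segment _ phi (fun=> kappa) 0 s (ltW s0)
  (fun t _ => phiE t) phic.
have : `|phi s - phi 0| <= 2 * C.
  by rewrite (le_trans (ler_normB _ _))// mulr_natl mulr2n lerD.
rewrite phiE' subr0 normrM (gtr0_norm s0) /s mulrC divfK ?normr_eq0//.
by rewrite leNgt ltrDl ltr01.
Qed.

End ActionAngle.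

(** * The bordered determinant and the conclusion *)

Lemma det_bordered_hess (R : realType) (d : nat) (F : 'rV[R]_d -> R) (I v : 'rV[R]_d) :
  v *m hess F I = grad F I ->
  \det (bordered_hess F I) = - (\det (hess F I) * \sum_j v 0 j * grad F I 0 j).
Proof.
move=> vhess.
(* Block elimination: subtracting [v] times the upper rows clears the lower left block and leaves
   the Schur complement in the corner. *)
have -> : bordered_hess F I = block_mx 1%:M 0 v 1%:M *m
    block_mx (hess F I) (grad F I)^T 0 (- (v *m (grad F I)^T)).
  rewrite mulmx_block !mul1mx !mul0mx !addr0 vhess.
  by rewrite subrr.
rewrite det_mulmx det_lblock det_ublock !det1 !mul1r det_mx11 mxE mulrN.
by congr (- (_ * _)); rewrite mxE; apply: eq_bigr => j _; rewrite [in LHS]mxE.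
Qed.

Theorem proposition0p6 (R : realType) (d : nat) (M : topologicalType)
    (A : smooth_manifold R d M) (g : riemannian_metric A)
    (H : cotangent A -> R) (p : 'I_d -> cotangent A -> R)
    (M_compact : compact [set: M])
    (H_homogeneous : forall (l : R) (z : cotangent A), 0 < l -> punctured z ->
       H (cot_scale l z) = l ^+ 2 * H z)
    (H_cosphere : [set z | punctured z /\ H z = 1] = cosphere g)
    (Hp_integrable : completely_integrable H p)
    (compact_regular_dense : open_dense_in (@punctured R d M A) (compact_regular_points p))
    (compact_regular_dense_cosphere :
       open_dense_in (cosphere g) (compact_regular_points p `&` cosphere g))
    (Hp_kolmogorov : kolmogorov_nondegenerate H p) :
  exists O : set (cotangent A),
    open_dense_in (cosphere g) O /\
    forall z, O z -> compact_regular_points p z /\ isoenergetic_at H p z.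
Proof.
exists (compact_regular_points p `&` cosphere g); split=> // z [cz Sz].
split=> //; have [B [Psi [F [y [aa By yz hess0]]]]] := Hp_kolmogorov z cz.
exists B, Psi, F, y; split=> //.
have [_ Hz1] : punctured z /\ H z = 1 by move: Sz; rewrite -H_cosphere.
have [[H_smooth _] _ _ _] := Hp_integrable.
(* Kolmogorov non-degeneracy makes the Hessian invertible, which provides the vector [v] of the
   preceding lemmas. *)
have vhess : grad F y.2 *m invmx (hess F y.2) *m hess F y.2 = grad F y.2.
  by rewrite mulmxKV// unitmxE unitfE.
rewrite (det_bordered_hess vhess) oppr_eq0 mulf_neq0//.
(* The remaining factor is [2 * F y.2 = 2 * H z], which is 2 on the cosphere bundle. *)
rewrite (hessian_quadratic_form aa H_smooth H_homogeneous By vhess).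
by rewrite -(aa_F aa By) yz Hz1 mulr1 pnatr_eq0.
Qed.
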